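(* For every graph $G$ (with $\bar{\lambda}(G)>0$), $\bar{\lambda}_{\max}(G)/\bar{\lambda}(G)\le 1/2$.
   Context: Graphs are finite and simple. For a graph $G$ of order $n$ and distinct vertices $u,v$, $\lambda_G(u,v)$ is the maximum number of edge-disjoint $u$--$v$ paths, and $\bar{\lambda}(G)=\binom{n}{2}^{-1}\sum_{\{u,v\}}\lambda_G(u,v)$ over unordered pairs of distinct vertices. An orientation of $G$ is obtained by directing each edge. For a digraph $D$, $\lambda_D(u,v)$ is the maximum number of arc-disjoint directed $u$--$v$ paths and $\bar{\lambda}(D)=\frac{1}{n(n-1)}\sum_{(u,v)}\lambda_D(u,v)$ over ordered pairs of distinct vertices; $\bar{\lambda}_{\max}(G)$ is the maximum of $\bar{\lambda}(D)$ over all orientations $D$ of $G$. *)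

(* Defs.v *)
From HB Require Import structures.
From mathcomp Require Import all_boot all_order all_algebra.

Set Implicit Arguments.
Unset Strict Implicit.
Unset Printing Implicit Defensive.

Import Order.TTheory GRing.Theory Num.Theory.
Local Open Scope ring_scope.

Section Connectivity.

Variable T : finType.

(* The sequence p lists the vertices of the path that follow the start u.     *)
Definition is_path (r : rel T) (u v : T) (p : seq T) : bool :=
  [&& path r u p, last u p == v & uniq (u :: p)].

Definition path_arcs (u : T) (p : seq T) : {set T * T} :=
  [set a in zip (u :: p) p].

Definition path_edges (u : T) (p : seq T) : {set {set T}} :=
  [set [set a.1; a.2] | a in path_arcs u p].

(* A path repeats no vertex, so it fits in #|T|.-bseq T.  For u != v every    *)
(* path uses an arc, so a family of disjoint paths has no repeated member     *)
(* and can be taken to be a set.                                              *)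
Definition edge_disjoint_paths (e : rel T) (u v : T)
    (P : {set #|T|.-bseq T}) : bool :=
  [forall p in P, is_path e u v p] &&
  [forall p in P, forall q in P,
     (p != q) ==> [disjoint path_edges u p & path_edges u q]].

Definition arc_disjoint_paths (d : rel T) (u v : T)
    (P : {set #|T|.-bseq T}) : bool :=
  [forall p in P, is_path d u v p] &&
  [forall p in P, forall q in P,
     (p != q) ==> [disjoint path_arcs u p & path_arcs u q]].

Definition lambda (e : rel T) (u v : T) : nat :=
  \max_(P : {set #|T|.-bseq T} | edge_disjoint_paths e u v P) #|P|.

Definition dilambda (d : rel T) (u v : T) : nat :=
  \max_(P : {set #|T|.-bseq T} | arc_disjoint_paths d u v P) #|P|.

(* For symmetric e, lambda e is symmetric; comparing enum_rank selects each   *)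
(* unordered pair {u, v} exactly once.                                        *)
Definition avg_lambda (e : rel T) : rat :=
  (\sum_(u : T) \sum_(v : T | (enum_rank u < enum_rank v)%N) lambda e u v)%N%:R
    / 'C(#|T|, 2)%:R.

Definition avg_dilambda (d : rel T) : rat :=
  (\sum_(u : T) \sum_(v : T | u != v) dilambda d u v)%N%:R
    / (#|T| * (#|T| - 1))%N%:R.

Definition arc_rel (A : {set T * T}) : rel T := fun x y => (x, y) \in A.

Definition is_orientation (e : rel T) (A : {set T * T}) : bool :=
  [forall x, forall y,
     if e x y then ((x, y) \in A) (+) ((y, x) \in A) else (x, y) \notin A].

(* The default 0 is harmless: avg_dilambda is nonnegative and every graph has *)
(* an orientation.                                                            *)
Definition max_avg_dilambda (e : rel T) : rat :=
  \big[Num.max/0]_(A : {set T * T} | is_orientation e A)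
    avg_dilambda (arc_rel A).

End Connectivity.

(* Main.v *)
Require Import Defs.
From mathcomp Require Import all_boot all_order all_algebra.
From mathcomp Require Import zify.
Import Order.TTheory GRing.Theory Num.Theory.
Local Open Scope ring_scope.
Set Implicit Arguments.
Unset Strict Implicit.
Unset Printing Implicit Defensive.

(** For each pair of vertices and each orientation D of G,
    lambda_D(u,v) + lambda_D(v,u) <= lambda_G(u,v); summing over pairs gives
    the theorem.  Let A and B be the arc sets of optimal families of directed
    u-v and v-u paths.  Traverse A \ B forwards and B \ A backwards: this is a
    unit flow from u to v of value lambda_D(u,v) + lambda_D(v,u) that uses each
    edge of G at most once, since D contains no 2-cycle.  Peeling off paths
    decomposes it into that many edge-disjoint u-v paths. *)

(** An arc set stands for the flow with one unit on each of its arcs; conservation at [x] means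
    value 0. *)
Definition net_outflow {T : finType} (A : {set T * T}) (x : T) : int :=
  \sum_(a in A) ((a.1 == x)%:R - (a.2 == x)%:R).

Definition reverse_arcs {T : finType} (A : {set T * T}) : {set T * T} :=
  [set a | (a.2, a.1) \in A].

(** The case [x = y] excludes loops as well. *)
Definition antisymmetric_arcs {T : finType} (A : {set T * T}) : Prop :=
  forall x y, (x, y) \in A -> (y, x) \notin A.

(** * Unit flows and their decomposition into paths *)

Section Flows.

Variable T : finType.
Implicit Types (A B F : {set T * T}) (u v x : T) (p : seq T).

Lemma net_outflow_setID A B x :
  net_outflow A x = net_outflow (A :&: B) x + net_outflow (A :\: B) x.
Proof. exact: big_setID. Qed.

Lemma net_outflowU A B x :
  [disjoint A & B] ->
  net_outflow (A :|: B) x = net_outflow A x + net_outflow B x.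
Proof.
by move=> dAB; rewrite /net_outflow -bigU //=; apply: eq_bigl => a; rewrite !inE.
Qed.

Lemma net_outflow_reverse A x :
  net_outflow (reverse_arcs A) x = - net_outflow A x.
Proof.
have swapK : cancel (fun a : T * T => (a.2, a.1)) (fun a => (a.2, a.1)).
  by case.
rewrite /net_outflow -sumrN (reindex_inj (can_inj swapK)) /=.
by apply: eq_big => [[a b]|a _]; rewrite ?inE ?opprB.
Qed.

Lemma net_outflow_bigcup (I : finType) (P : {set I}) (F : I -> {set T * T}) x :
  (forall i j, i \in P -> j \in P -> i != j -> [disjoint F i & F j]) ->
  net_outflow (\bigcup_(i in P) F i) x = \sum_(i in P) net_outflow (F i) x.
Proof.
(* Indices outside [P] get the empty set, so that disjointness holds over all of [I]. *)
move=> dF; rewrite /net_outflow [\bigcup_(i in P) _]big_mkcond /=.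
rewrite partition_disjoint_bigcup /=.
  rewrite [RHS]big_mkcond; apply: eq_bigr => i _.
  by case: ifP => // _; rewrite big_set0.
move=> i j nij; case: ifP => Pi; last by rewrite disjoints_subset sub0set.
case: ifP => Pj; first exact: dF.
by rewrite disjoint_sym disjoints_subset sub0set.
Qed.

(** After exchanging sums, an arc inside [R] contributes 0, an arc entering [R] contributes -1, and
    none leaves [R]. *)
Lemma sum_net_outflow_closed A (R : {set T}) :
  (forall a, a \in A -> a.1 \in R -> a.2 \in R) ->
  \sum_(x in R) net_outflow A x <= 0.
Proof.
move=> clR; rewrite /net_outflow exchange_big /=.
have ind (y : T) : \sum_(x in R) (y == x)%:R = (y \in R)%:R :> int.
  case yR: (y \in R); last first.
    by rewrite big1 // => x xR; case: eqP => // yx; rewrite yx xR in yR.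
  rewrite (bigD1 y) //= eqxx big1 ?addr0 // => x /andP[_ /negbTE].
  by rewrite eq_sym => ->.
apply: sumr_le0 => a aA; rewrite sumrB !ind.
by have := clR _ aA; case: (_ \in R) => // [->|_] //; case: (_ \in R).
Qed.

Lemma path_arcs_nil u : path_arcs u [::] = set0.
Proof. by apply/setP=> a; rewrite !inE. Qed.

Lemma path_arcs_cons u y p :
  path_arcs u (y :: p) = (u, y) |: path_arcs y p.
Proof. by apply/setP=> a; rewrite !inE. Qed.

Lemma path_arcs_start u p a : a \in path_arcs u p -> a.1 \in u :: p.
Proof.
elim: p u => [|y p IHp] u; first by rewrite path_arcs_nil inE.
rewrite path_arcs_cons => /setU1P[->|/IHp]; first exact: mem_head.
by move=> a_p; rewrite inE a_p orbT.
Qed.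

Lemma net_outflow_path_arcs u p x :
  uniq (u :: p) ->
  net_outflow (path_arcs u p) x = (u == x)%:R - (last u p == x)%:R.
Proof.
elim: p u => [|y p IHp] u.
  by rewrite path_arcs_nil /net_outflow big_set0 subrr.
move=> /= /andP[u_p uniq_p]; rewrite path_arcs_cons /net_outflow big_setU1.
  by rewrite -/(net_outflow _ _) IHp //= addrA subrK.
by apply: contra u_p => /path_arcs_start.
Qed.

Lemma path_arcs_sub F u p : path (arc_rel F) u p -> path_arcs u p \subset F.
Proof.
elim: p u => [|y p IHp] u /=; first by rewrite path_arcs_nil sub0set.
by case/andP=> uy /IHp sp; rewrite path_arcs_cons subUset sub1set sp andbT.
Qed.

Lemma is_path_sub F F' u v p :
  F \subset F' -> is_path (arc_rel F) u v p -> is_path (arc_rel F') u v p.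
Proof.
move=> sF /and3P[pth l un]; rewrite /is_path l un !andbT.
by apply: sub_path pth => x y; apply: (subsetP sF).
Qed.

Lemma is_path_arcs_neq0 (r : rel T) u v p :
  u != v -> is_path r u v p -> path_arcs u p != set0.
Proof.
case: p => [|y p] uv /and3P[_ /= l _]; first by rewrite l in uv.
by apply/set0Pn; exists (u, y); rewrite path_arcs_cons setU11.
Qed.

(* Otherwise no arc leaves the set reachable from u, which then cannot have
   positive total net outflow. *)
Lemma flow_path F u v :
  0 < net_outflow F u ->
  (forall x, x != u -> x != v -> net_outflow F x = 0) ->
  exists p, is_path (arc_rel F) u v p.
Proof.
move=> Fu F0; have [uv|nuv] := boolP (connect (arc_rel F) u v).
  case/connectP: uv => p pth ->; case: (shortenP pth) => q qp un _.
  by exists q; rewrite /is_path qp eqxx un.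
pose R := [set x | connect (arc_rel F) u x].
have clR a : a \in F -> a.1 \in R -> a.2 \in R.
  case: a => x y xyF; rewrite !inE => ux.
  exact: connect_trans ux (connect1 xyF).
have := sum_net_outflow_closed clR.
rewrite (bigD1 u) ?inE ?connect0 //= big1 ?addr0; first by rewrite leNgt Fu.
move=> x; rewrite inE => /andP[ux xu]; apply: F0 => //.
by apply: contraNneq nuv => <-.
Qed.

(** Induction on [m]: deleting the arcs of one path lowers the net outflow at [u] by one and
    preserves conservation away from [u] and [v]. Cycles may remain in [F] at the end. *)
Lemma flow_decomposition F u v m :
  u != v -> net_outflow F u = m%:R ->
  (forall x, x != u -> x != v -> net_outflow F x = 0) ->
  exists2 P : {set #|T|.-bseq T},
    arc_disjoint_paths (arc_rel F) u v P & #|P| = m.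
Proof.
move=> uv; elim: m F => [|m IHm] F Fu F0.
  exists set0; last by rewrite cards0.
  by apply/andP; split; apply/forall_inP => p; rewrite inE.
have [|p pP] := @flow_path F u v _ F0; first by rewrite Fu ltr0Sn.
have /and3P[pth /eqP lp un] := pP.
have sp := path_arcs_sub pth.
have rest x : net_outflow (F :\: path_arcs u p) x =
    net_outflow F x - ((u == x)%:R - (v == x)%:R).
  rewrite (net_outflow_setID F (path_arcs u p)) (setIidPr sp).
  by rewrite net_outflow_path_arcs // lp addrAC subrr add0r.
have [||P /andP[/forall_inP Pp /forall_inP Pd] cP] := IHm (F :\: path_arcs u p).
- by rewrite rest Fu eqxx eq_sym (negbTE uv) subr0 -natr1 addrK.
- by move=> x xu xv; rewrite rest F0 // ![_ == x]eq_sym (negbTE xu) (negbTE xv).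
have szp : (size p <= #|T|)%N.
  by rewrite ltnW // -[(size p).+1]/(size (u :: p)) -(card_uniqP un) max_card.
pose b := Bseq szp.
have dis (q : #|T|.-bseq T) : q \in P -> [disjoint path_arcs u b & path_arcs u q].
  move=> /Pp/and3P[/path_arcs_sub sq _ _]; rewrite disjoint_sym disjoints_subset.
  by apply: subset_trans sq _; rewrite setDE subsetIr.
(* Otherwise the nonempty arc set of [b] would be disjoint from itself; hence adding [b] increases
   the cardinality. *)
have bP : b \notin P.
  apply/negP => /[dup] /dis; rewrite -setI_eq0 setIid => /eqP b0 _.
  by have := is_path_arcs_neq0 uv pP; rewrite b0 eqxx.
exists (b |: P); last by rewrite cardsU1 bP cP.
apply/andP; split; apply/forall_inP => q /setU1P[-> //|qP].
- exact: is_path_sub (subsetDl _ _) (Pp _ qP).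
- apply/forall_inP => r /setU1P[->|rP]; first by rewrite eqxx.
  by rewrite dis ?implybT.
- apply/forall_inP => r /setU1P[->|rP]; last by have /forall_inP := Pd _ qP; apply.
  by rewrite disjoint_sym dis ?implybT.
Qed.

End Flows.

(** * From orientations to edge-disjoint paths and averages *)

Section Orientations.

Variable T : finType.
Implicit Types (A B F : {set T * T}) (u v x : T) (d e : rel T).

(** The empty family is admissible, so the maximum is attained. *)
Lemma dilambda_witness d u v :
  exists2 P, arc_disjoint_paths d u v P & dilambda d u v = #|P|.
Proof.
have [|P PP] := @eq_bigmax_cond _ (arc_disjoint_paths d u v)
  (fun P : {set #|T|.-bseq T} => #|P|); last by move=> maxP; exists P.
apply/card_gt0P; exists set0.
by apply/andP; split; apply/forall_inP => p; rewrite inE.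
Qed.

Lemma arc_disjoint_paths_flow A u v (P : {set #|T|.-bseq T}) :
  arc_disjoint_paths (arc_rel A) u v P ->
  exists2 F : {set T * T}, F \subset A &
    forall x, net_outflow F x = ((u == x)%:R - (v == x)%:R) *+ #|P|.
Proof.
case/andP=> /forall_inP Pp /forall_inP Pd.
exists (\bigcup_(p in P) path_arcs u p).
  by apply/bigcupsP => p /Pp/and3P[/path_arcs_sub].
move=> x; rewrite net_outflow_bigcup.
  rewrite -sumr_const; apply: eq_bigr => p /Pp/and3P[_ /eqP lp un].
  by rewrite net_outflow_path_arcs // lp.
by move=> p q pP qP pq; have /forall_inP/(_ q qP)/implyP := Pd _ pP; apply.
Qed.

(** Arc-disjoint paths can share an edge only by crossing it in opposite directions, which
    antisymmetry forbids. *)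
Lemma edge_disjoint_of_arc_disjoint e F u v (P : {set #|T|.-bseq T}) :
  antisymmetric_arcs F -> (forall x y, (x, y) \in F -> e x y) ->
  arc_disjoint_paths (arc_rel F) u v P -> edge_disjoint_paths e u v P.
Proof.
move=> asF Fe /andP[/forall_inP Pp /forall_inP Pd]; apply/andP; split.
  apply/forall_inP => p /Pp/and3P[pth l un]; rewrite /is_path l un !andbT.
  by apply: sub_path pth => x y; apply: Fe.
apply/forall_inP => p pP; apply/forall_inP => q qP; apply/implyP => pq.
have /forall_inP/(_ q qP)/implyP/(_ pq) dpq := Pd _ pP.
have /and3P[/path_arcs_sub/subsetP sp _ _] := Pp _ pP.
have /and3P[/path_arcs_sub/subsetP sq _ _] := Pp _ qP.
rewrite -setI_eq0; apply/eqP/setP => E; rewrite [RHS]inE; apply/negP.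
case/setIP => /imsetP[[a b] ap ->] /imsetP[[c f] cq /= /setP eqE].
have [/= ac|/= nac] := eqVneq (a, b) (c, f).
  by have := disjointFr dpq ap; rewrite ac cq.
(* Testing [{a, b} = {c, f}] at the four endpoints leaves only [(a, b) = (f, c)]. *)
have := eqE a; have := eqE b; have := eqE c; have := eqE f.
rewrite !inE !eqxx ?orbT ?orTb.
have Fab := sp _ ap; have Fcf := sq _ cq.
have ab : a != b by apply/eqP => E'; have := asF _ _ Fab; rewrite E' -{1}E' Fab.
have cf : c != f by apply/eqP => E'; have := asF _ _ Fcf; rewrite E' -{1}E' Fcf.
move=> fab cab bcf acf.
have [ac|nca] := eqVneq a c.
  move: bcf; rewrite -ac eq_sym (negbTE ab) /= => /esym/eqP bf.
  by rewrite ac bf eqxx in nac.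
move: acf; rewrite (negbTE nca) /= => /esym/eqP af.
move: cab; rewrite eq_sym (negbTE nca) /= => /eqP cb.
by have := asF _ _ Fab; rewrite af -cb Fcf.
Qed.

Lemma orientation_antisym e A : is_orientation e A -> antisymmetric_arcs A.
Proof.
move=> /forallP oA x y xyA; have /forallP/(_ y) := oA x.
by case: (e x y); rewrite xyA.
Qed.

Lemma orientation_sub e A x y : is_orientation e A -> (x, y) \in A -> e x y.
Proof.
by move=> /forallP/(_ x)/forallP/(_ y); case: (e x y) => // /negbTE->.
Qed.

Lemma dilambda_add_le_lambda e A u v :
  symmetric e -> is_orientation e A -> u != v ->
  (dilambda (arc_rel A) u v + dilambda (arc_rel A) v u <= lambda e u v)%N.
Proof.
move=> e_sym oA uv; have asA := orientation_antisym oA.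
have [P PP ->] := dilambda_witness (arc_rel A) u v.
have [Q QQ ->] := dilambda_witness (arc_rel A) v u.
have [B /subsetP sB fB] := arc_disjoint_paths_flow PP.
have [C /subsetP sC fC] := arc_disjoint_paths_flow QQ.
(* The contributions of [B :&: C] cancel, so the net outflow of [F] is that of [B] minus that of
   [C]. *)
pose F := (B :\: C) :|: reverse_arcs (C :\: B).
have fF x : net_outflow F x = ((u == x)%:R - (v == x)%:R) *+ (#|P| + #|Q|).
  rewrite net_outflowU; last first.
    rewrite -setI_eq0; apply/eqP/setP => -[a b]; rewrite !inE /=.
    apply/negP => /andP[/andP[_ /sB abA] /andP[_ /sC]].
    by apply/negP; apply: asA.
  rewrite net_outflow_reverse.
  have := net_outflow_setID B C x; have := net_outflow_setID C B x.
  rewrite fB fC setIC mulrnDr -(opprB (u == x)%:R) mulNrn.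
  lia.
(* Here discarding [B :&: C] matters: a common arc would enter [F] in both directions. *)
have asF : antisymmetric_arcs F.
  move=> x y; rewrite !inE /= => /orP[] /andP[n1 i1].
    by rewrite (negbTE n1) /= andbF orbF; apply/nandP; right;
       apply: contra (asA _ _ (sB _ i1)) => /sB.
  rewrite (negbTE n1) andbF /=.
  by apply/nandP; right; apply: contra (asA _ _ (sC _ i1)) => /sC.
have Fe x y : (x, y) \in F -> e x y.
  rewrite !inE /= => /orP[] /andP[_]; first by move/sB/(orientation_sub oA).
  by rewrite e_sym; move/sC/(orientation_sub oA).
have [||S SS <-] := @flow_decomposition _ F u v (#|P| + #|Q|) uv.
- by rewrite fF eqxx eq_sym (negbTE uv) subr0.
- by move=> x xu xv; rewrite fF ![_ == x]eq_sym (negbTE xu) (negbTE xv) subrr mul0rn.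
apply: (@leq_bigmax_cond _ _ (fun P : {set #|T|.-bseq T} => #|P|)).
exact: edge_disjoint_of_arc_disjoint SS.
Qed.

(** Split by which endpoint has the smaller rank and swap the names in one half; this matches the
    indexing of [avg_lambda]. *)
Lemma sum_ordered_pairs (f : T -> T -> nat) :
  (\sum_u \sum_(v | u != v) f u v =
   \sum_u \sum_(v | enum_rank u < enum_rank v) (f u v + f v u))%N.
Proof.
under [RHS]eq_bigr do rewrite big_split.
rewrite big_split /= [X in (_ + X)%N](exchange_big_dep xpredT) //= -big_split.
apply: eq_bigr => u _; rewrite (bigID (fun v => enum_rank u < enum_rank v)%N) /=.
congr addn; apply: eq_bigl => v; rewrite -(inj_eq enum_rank_inj) -val_eqE /=;
  by case: ltngtP.
Qed.

Lemma avg_dilambda_le e A :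
  symmetric e -> is_orientation e A ->
  avg_dilambda (arc_rel A) <= avg_lambda e / 2.
Proof.
move=> e_sym oA; rewrite /avg_dilambda /avg_lambda subn1.
(* The factor 1/2 arises from counting ordered against unordered pairs. *)
have -> : (#|T| * #|T|.-1 = 'C(#|T|, 2) * 2)%N.
  by rewrite -[2%N in RHS]/(2`!) bin_ffact ffactnS ffactn1.
rewrite natrM invfM mulrA ler_pM2r ?invr_gt0 ?ltr0n //.
(* With fewer than two vertices the binomial and its inverse are both 0, so this factor is only
   known to be nonnegative. *)
rewrite ler_wpM2r ?invr_ge0 ?ler0n // ler_nat sum_ordered_pairs.
apply: leq_sum => u _; apply: leq_sum => v uv.
by apply: dilambda_add_le_lambda => //; apply: contraTneq uv => ->; rewrite ltnn.
Qed.

End Orientations.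

Theorem theorem2p5 (T : finType) (e : rel T)
    (e_sym : symmetric e) (e_irr : irreflexive e)
    (e_pos : 0 < avg_lambda e) :
  max_avg_dilambda e / avg_lambda e <= 1 / 2.
Proof.
rewrite ler_pdivrMr // mulrC mul1r.
(* The default 0 of the maximum must satisfy the bound too. *)
apply: bigmax_le => [|A oA]; first by rewrite divr_ge0 // ltW.
exact: avg_dilambda_le.
Qed.
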